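(* Assume the standing setting and the approximation setting of the context, let $\Theta\in(0,1)$, and assume the stability conditions (S1), (S2), (S-w) and the consistency conditions (C1), (C2). Then the weighted splitting with spatial approximation is convergent at every time level $t>0$: for every $x\in X$, $$\lim_{n,m\to\infty}J_m\big[\Theta S_m(t/n)T_m(t/n)+(1-\Theta)T_m(t/n)S_m(t/n)\big]^nP_mx=U(t)x.$$
   Context: Standing setting: $X$ is a Banach space; $A$, $B$ are closed densely defined operators generating strongly continuous semigroups $(T(t))_{t\ge0}$, $(S(t))_{t\ge0}$ on $X$; the closure $\overline{A+B}$ satisfies $D(A)\cap D(B)\subset D(\overline{A+B})$ and generates a strongly continuous semigroup $(U(t))_{t\ge0}$. Approximation setting: $X_m$ ($m\in\mathbb{N}$) are Banach spaces, $P_m:X\to X_m$, $J_m:X_m\to X$ bounded linear operators with $P_mJ_m=I_m$, $J_mP_mx\to x$ for all $x\in X$, and $\|J_m\|\le M_J$, $\|P_m\|\le M_P$ for all $m$. Operators $A_m$, $B_m$ generate strongly continuous semigroups $(T_m(t))_{t\ge0}$, $(S_m(t))_{t\ge0}$ on $X_m$. Stability: (S1) there are $M_T\ge1$, $\omega_T$ with $\|T(h)\|,\|T_m(h)\|\le M_Te^{\omega_Th}$ for all $h>0$, $m$; (S2) there are $M_S\ge1$, $\omega_S$ with $\|S(h)\|,\|S_m(h)\|\le M_Se^{\omega_Sh}$ for all $h>0$, $m$; (S-w) there are $M\ge1$, $\omega\in\mathbb{R}$ with $\|[\Theta S_m(t/n)T_m(t/n)+(1-\Theta)T_m(t/n)S_m(t/n)]^k\|\le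 Me^{k\omega t/n}$ for all $t\ge0$, $k,n,m\in\mathbb{N}$. Consistency: (C1) $J_mA_mP_mx\to Ax$ for all $x\in D(A)$; (C2) $J_mB_mP_mx\to Bx$ for all $x\in D(B)$. A double limit $\lim_{n,m\to\infty}a_{n,m}=a$ means: for every $\varepsilon>0$ there is $N$ with $\|a_{n,m}-a\|\le\varepsilon$ for all $n,m\ge N$. *)

(* Defs.v *)
From Stdlib Require Import Reals.
Open Scope R_scope.

Record Banach := {
  bs :> Type;
  bzero : bs;
  badd : bs -> bs -> bs;
  bopp : bs -> bs;
  bscal : R -> bs -> bs;
  bnorm : bs -> R;
  badd_assoc : forall x y z, badd x (badd y z) = badd (badd x y) z;
  badd_comm : forall x y, badd x y = badd y x;
  badd_0 : forall x, badd x bzero = x;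
  badd_opp : forall x, badd x (bopp x) = bzero;
  bscal_1 : forall x, bscal 1 x = x;
  bscal_assoc : forall a b x, bscal a (bscal b x) = bscal (a * b) x;
  bscal_distr_l : forall a x y, bscal a (badd x y) = badd (bscal a x) (bscal a y);
  bscal_distr_r : forall a b x, bscal (a + b) x = badd (bscal a x) (bscal b x);
  bnorm_eq0 : forall x, bnorm x = 0 -> x = bzero;
  bnorm_scal : forall a x, bnorm (bscal a x) = Rabs a * bnorm x;
  bnorm_triangle : forall x y, bnorm (badd x y) <= bnorm x + bnorm y;
  bcomplete : forall u : nat -> bs,
    (forall eps, 0 < eps -> exists N, forall p q, (N <= p)%nat -> (N <= q)%nat ->
        bnorm (badd (u p) (bopp (u q))) < eps) ->
    exists l, forall eps, 0 < eps -> exists N, forall p, (N <= p)%nat ->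
        bnorm (badd (u p) (bopp l)) < eps
}.

Arguments bzero {b0}.
Arguments badd {b0}.
Arguments bopp {b0}.
Arguments bscal {b0}.
Arguments bnorm {b0}.

Definition bsub {X : Banach} (x y : X) : X := badd x (bopp y).

Definition seq_lim {X : Banach} (u : nat -> X) (l : X) : Prop :=
  forall eps, 0 < eps -> exists N, forall k, (N <= k)%nat -> bnorm (bsub (u k) l) < eps.

Definition lim_0plus {X : Banach} (f : R -> X) (l : X) : Prop :=
  forall eps, 0 < eps -> exists delta, 0 < delta /\
    forall h, 0 < h -> h < delta -> bnorm (bsub (f h) l) < eps.

Definition double_lim {X : Banach} (a : nat -> nat -> X) (l : X) : Prop :=
  forall eps, 0 < eps -> exists N, forall n m, (N <= n)%nat -> (N <= m)%nat ->
    bnorm (bsub (a n m) l) <= eps.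

Definition is_linear {X Y : Banach} (f : X -> Y) : Prop :=
  (forall x y, f (badd x y) = badd (f x) (f y)) /\
  (forall a x, f (bscal a x) = bscal a (f x)).

Definition opnorm_le {X Y : Banach} (f : X -> Y) (c : R) : Prop :=
  forall x, bnorm (f x) <= c * bnorm x.

Definition bounded_linear {X Y : Banach} (f : X -> Y) : Prop :=
  is_linear f /\ exists c, opnorm_le f c.

(* Strongly continuous semigroup (T(t))_{t>=0}; values at t < 0 are irrelevant. *)
Definition C0_semigroup {X : Banach} (T : R -> X -> X) : Prop :=
  (forall t, 0 <= t -> bounded_linear (T t)) /\
  (forall x, T 0 x = x) /\
  (forall t s x, 0 <= t -> 0 <= s -> T (t + s) x = T t (T s x)) /\
  (forall x t0, 0 <= t0 -> forall eps, 0 < eps -> exists delta, 0 < delta /\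
     forall t, 0 <= t -> Rabs (t - t0) < delta -> bnorm (bsub (T t x) (T t0 x)) < eps).

(* An (unbounded) operator is a domain D together with a map A, relevant on D.
   (D, A) is the generator of T:  x in D and A x = y  iff
   lim_{h->0+} (T h x - x)/h = y. *)
Definition generates {X : Banach} (D : X -> Prop) (A : X -> X) (T : R -> X -> X) : Prop :=
  C0_semigroup T /\
  forall x y, (D x /\ A x = y) <-> lim_0plus (fun h => bscal (/ h) (bsub (T h x) x)) y.

Definition densely_defined {X : Banach} (D : X -> Prop) : Prop :=
  forall x eps, 0 < eps -> exists y, D y /\ bnorm (bsub x y) < eps.

Definition closed_op {X : Banach} (D : X -> Prop) (A : X -> X) : Prop :=
  forall (u : nat -> X) x y, (forall k, D (u k)) -> seq_lim u x ->
    seq_lim (fun k => A (u k)) y -> D x /\ A x = y.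

(* (D, C) is the closure of the operator (D0, A0): its graph is the closure of
   the graph of (D0, A0) in X x X (in particular (D0, A0) is closable). *)
Definition is_closure {X : Banach} (D0 : X -> Prop) (A0 : X -> X)
  (D : X -> Prop) (C : X -> X) : Prop :=
  forall x y, (D x /\ C x = y) <->
    exists u : nat -> X, (forall k, D0 (u k)) /\ seq_lim u x /\
      seq_lim (fun k => A0 (u k)) y.

Definition weighted_op {Y : Banach} (Theta : R) (S T : R -> Y -> Y) (h : R) (y : Y) : Y :=
  badd (bscal Theta (S h (T h y))) (bscal (1 - Theta) (T h (S h y))).

(* Main.v *)
(** A Lax-type argument that avoids resolvents. Write [V_m(h)] for one step of the
    weighted splitting and [G] for the closure of [A + B]. On the core [D(A) ∩ D(B)] one has
    [V_m(h) P_m y = P_m y + h P_m (A + B) y + o(h)] uniformly in large [m]. The core need not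
    be invariant under [U], so an orbit [U(s) x] with [x ∈ D(G)] is replaced by a polygonal
    path whose vertices lie in the core and are close to the orbit in graph norm: since
    [s ↦ U(s) G x] is continuous, on a short interval both the slope of the path and [A + B]
    along it are close to [U(s) G x]. Finitely many core elements are involved, so
    consistency is uniform along the path, and stability turns it into an error estimate by
    telescoping. Density of [D(G)] and boundedness of [U(t)] give all [x]. Compactness in
    time enters only through real induction. *)

Require Import Defs.
From Stdlib Require Import Reals Lra Lia List ClassicalEpsilon.
Open Scope R_scope.

Local Notation "x ⊕ y" := (badd x y) (at level 50, left associativity).
Local Notation "x ⊖ y" := (bsub x y) (at level 50, left associativity).
Local Notation "a ⊙ x" := (bscal a x) (at level 40, left associativity).

(** * Vector space identities from the axioms *)

Lemma badd_0_l (X : Banach) (x : X) : bzero ⊕ x = x.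
Proof. rewrite badd_comm; apply badd_0. Qed.

Lemma badd_cancel (X : Banach) (x y z : X) : x ⊕ y = x ⊕ z -> y = z.
Proof.
  intro H; rewrite <- (badd_0_l X y), <- (badd_0_l X z), <- (badd_opp X x).
  rewrite (badd_comm X x (bopp x)), <- !badd_assoc, H; reflexivity.
Qed.

Lemma bscal_0_l (X : Banach) (x : X) : 0 ⊙ x = bzero.
Proof.
  apply (badd_cancel X (0 ⊙ x)).
  rewrite <- bscal_distr_r, badd_0; f_equal; ring.
Qed.

Lemma bscal_0_r (X : Banach) (a : R) : a ⊙ (bzero : X) = bzero.
Proof.
  apply (badd_cancel X (a ⊙ bzero)).
  rewrite <- bscal_distr_l, !badd_0; reflexivity.
Qed.

Lemma bopp_scal (X : Banach) (x : X) : bopp x = (-1) ⊙ x.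
Proof.
  apply (badd_cancel X x); rewrite badd_opp.
  rewrite <- (bscal_1 X x) at 1; rewrite <- bscal_distr_r.
  replace (1 + -1) with 0 by ring; symmetry; apply bscal_0_l.
Qed.

(** * A decision procedure for linear identities *)

(** Vectors become indices into an environment, while scalars stay terms of [R], so that
    coefficients can be handed to [ring] or [field]. *)
Inductive vexpr :=
| VZero
| VAtom (i : nat)
| VAdd (e f : vexpr)
| VSub (e f : vexpr)
| VOpp (e : vexpr)
| VScal (a : R) (e : vexpr).

Fixpoint veval {X : Banach} (env : list X) (e : vexpr) : X :=
  match e with
  | VZero => bzero
  | VAtom i => nth i env bzero
  | VAdd e f => veval env e ⊕ veval env f
  | VSub e f => veval env e ⊖ veval env f
  | VOpp e => bopp (veval env e)
  | VScal a e => a ⊙ veval env e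
  end.

Fixpoint vcoef (e : vexpr) (i : nat) : R :=
  match e with
  | VZero => 0
  | VAtom j => if Nat.eqb j i then 1 else 0
  | VAdd e f => vcoef e i + vcoef f i
  | VSub e f => vcoef e i - vcoef f i
  | VOpp e => - vcoef e i
  | VScal a e => a * vcoef e i
  end.

Fixpoint lincomb {X : Banach} (env : list X) (c : nat -> R) : X :=
  match env with
  | nil => bzero
  | x :: l => c 0%nat ⊙ x ⊕ lincomb l (fun i => c (S i))
  end.

Lemma lincomb_0 (X : Banach) (env : list X) (c : nat -> R) :
  (forall i, c i = 0) -> lincomb env c = bzero.
Proof.
  revert c; induction env as [|x l IH]; intros c H; simpl; [reflexivity|].
  rewrite H, IH, bscal_0_l, badd_0 by (intro; apply H); reflexivity.
Qed.

Lemma lincomb_nth (X : Banach) (env : list X) (j : nat) :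
  lincomb env (fun i => if Nat.eqb j i then 1 else 0) = nth j env bzero.
Proof.
  revert j; induction env as [|x l IH]; intros [|j]; simpl; try reflexivity.
  - rewrite lincomb_0, badd_0 by reflexivity; apply bscal_1.
  - rewrite IH, bscal_0_l; apply badd_0_l.
Qed.

Lemma badd_swap (X : Banach) (a b c d : X) :
  (a ⊕ b) ⊕ (c ⊕ d) = (a ⊕ c) ⊕ (b ⊕ d).
Proof.
  rewrite <- !badd_assoc; f_equal; rewrite !badd_assoc; f_equal; apply badd_comm.
Qed.

Lemma lincomb_add (X : Banach) (env : list X) (c d : nat -> R) :
  lincomb env c ⊕ lincomb env d = lincomb env (fun i => c i + d i).
Proof.
  revert c d; induction env as [|x l IH]; intros c d; simpl; [apply badd_0|].
  rewrite badd_swap, IH, <- bscal_distr_r; reflexivity.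
Qed.

Lemma lincomb_scal (X : Banach) (env : list X) (a : R) (c : nat -> R) :
  a ⊙ lincomb env c = lincomb env (fun i => a * c i).
Proof.
  revert c; induction env as [|x l IH]; intros c; simpl; [apply bscal_0_r|].
  rewrite bscal_distr_l, IH, bscal_assoc; reflexivity.
Qed.

(** Recursion on [n], rather than a quantifier over indices, lets [cbn] unfold this to a finite
    conjunction of scalar equations. *)
Fixpoint coef_eq (n : nat) (c d : nat -> R) : Prop :=
  match n with
  | O => True
  | S n => c 0%nat = d 0%nat /\ coef_eq n (fun i => c (S i)) (fun i => d (S i))
  end.

Lemma lincomb_ext (X : Banach) (env : list X) (c d : nat -> R) :
  coef_eq (length env) c d -> lincomb env c = lincomb env d.
Proof.
  revert c d; induction env as [|x l IH]; intros c d; simpl; [reflexivity|].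
  intros [H1 H2]; rewrite H1; f_equal; apply IH, H2.
Qed.

Lemma coef_eq_all (n : nat) (c d : nat -> R) :
  (forall i, c i = d i) -> coef_eq n c d.
Proof.
  revert c d; induction n as [|n IH]; intros c d H; simpl; [exact I|].
  split; [apply H | apply IH; intro; apply H].
Qed.

Lemma veval_lincomb (X : Banach) (env : list X) (e : vexpr) :
  veval env e = lincomb env (vcoef e).
Proof.
  induction e as [|i|e IHe f IHf|e IHe f IHf|e IHe|a e IHe]; simpl.
  - symmetry; apply lincomb_0; reflexivity.
  - symmetry; apply lincomb_nth.
  - rewrite IHe, IHf; apply lincomb_add.
  - unfold bsub; rewrite IHe, IHf, bopp_scal, lincomb_scal, lincomb_add.
    apply lincomb_ext, coef_eq_all; intro; ring.
  - rewrite IHe, bopp_scal, lincomb_scal.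
    apply lincomb_ext, coef_eq_all; intro; ring.
  - rewrite IHe; apply lincomb_scal.
Qed.

Lemma veval_eq (X : Banach) (env : list X) (e f : vexpr) :
  coef_eq (length env) (vcoef e) (vcoef f) -> veval env e = veval env f.
Proof. intro H; rewrite !veval_lincomb; apply lincomb_ext, H. Qed.

Ltac atom_add x l :=
  match l with
  | nil => constr:(x :: nil)
  | x :: _ => l
  | ?y :: ?l' => let r := atom_add x l' in constr:(y :: r)
  end.

Ltac atom_index x l :=
  match l with
  | x :: _ => constr:(0%nat)
  | _ :: ?l' => let i := atom_index x l' in constr:(S i)
  end.

Ltac atoms e l :=
  match e with
  | badd ?a ?b => let l' := atoms a l in atoms b l'
  | bsub ?a ?b => let l' := atoms a l in atoms b l'
  | bopp ?a => atoms a l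
  | bscal _ ?a => atoms a l
  | bzero => l
  | _ => atom_add e l
  end.

Ltac reify e l :=
  match e with
  | badd ?a ?b => let x := reify a l in let y := reify b l in constr:(VAdd x y)
  | bsub ?a ?b => let x := reify a l in let y := reify b l in constr:(VSub x y)
  | bopp ?a => let x := reify a l in constr:(VOpp x)
  | bscal ?r ?a => let x := reify a l in constr:(VScal r x)
  | bzero => constr:(VZero)
  | _ => let i := atom_index e l in constr:(VAtom i)
  end.

Ltac vec_core tac :=
  match goal with
  | |- @eq (bs ?X) ?a ?b =>
    let l0 := constr:(@nil (bs X)) in
    let l1 := atoms a l0 in
    let l := atoms b l1 in
    let ea := reify a l in
    let eb := reify b l in
    change (veval l ea = veval l eb);
    apply veval_eq; cbn [length coef_eq vcoef Nat.eqb];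
    repeat split; tac
  end.

Ltac vec := vec_core ltac:(first [ring | field; repeat split; lra]).

(** * Norm estimates *)

Lemma bnorm_0 (X : Banach) : bnorm (bzero : X) = 0.
Proof. rewrite <- (bscal_0_l X bzero), bnorm_scal, Rabs_R0; ring. Qed.

Lemma bnorm_opp (X : Banach) (x : X) : bnorm (bopp x) = bnorm x.
Proof. rewrite bopp_scal, bnorm_scal, Rabs_left by lra; ring. Qed.

Lemma bnorm_ge0 (X : Banach) (x : X) : 0 <= bnorm x.
Proof.
  pose proof (bnorm_triangle X x (bopp x)) as H.
  rewrite badd_opp, bnorm_0, bnorm_opp in H; lra.
Qed.

Lemma bnorm_sub_sym (X : Banach) (x y : X) : bnorm (x ⊖ y) = bnorm (y ⊖ x).
Proof. rewrite <- bnorm_opp; f_equal; vec. Qed.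

Lemma bsub_eq0 (X : Banach) (x y : X) : x ⊖ y = bzero -> x = y.
Proof. intro H; transitivity ((x ⊖ y) ⊕ y); [vec | rewrite H; vec]. Qed.

Lemma bnorm_add2 (X : Banach) (a b v : X) (ca cb c : R) :
  v = a ⊕ b -> bnorm a <= ca -> bnorm b <= cb -> ca + cb <= c -> bnorm v <= c.
Proof. intros -> ? ? ?; pose proof (bnorm_triangle X a b); lra. Qed.

Lemma bnorm_add3 (X : Banach) (a b d v : X) (ca cb cd c : R) :
  v = a ⊕ b ⊕ d -> bnorm a <= ca -> bnorm b <= cb -> bnorm d <= cd ->
  ca + cb + cd <= c -> bnorm v <= c.
Proof.
  intros -> ? ? ? ?; pose proof (bnorm_triangle X a b).
  pose proof (bnorm_triangle X (a ⊕ b) d); lra.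
Qed.

Lemma bnorm_scal_le (X : Banach) (a c : R) (x : X) :
  0 <= a -> bnorm x <= c -> bnorm (a ⊙ x) <= a * c.
Proof. intros; rewrite bnorm_scal, Rabs_right by lra; apply Rmult_le_compat_l; assumption. Qed.

Lemma is_linear_sub (X Y : Banach) (f : X -> Y) (x y : X) :
  is_linear f -> f (x ⊖ y) = f x ⊖ f y.
Proof.
  intros [Ha Hs]; unfold bsub; rewrite Ha, !bopp_scal, Hs; reflexivity.
Qed.

Lemma is_linear_0 (X Y : Banach) (f : X -> Y) : is_linear f -> f bzero = bzero.
Proof. intros [_ Hs]; rewrite <- (bscal_0_l X bzero), Hs; apply bscal_0_l. Qed.

Lemma opnorm_bound (X Y : Banach) (f : X -> Y) (c r : R) (x : X) :
  0 <= c -> opnorm_le f c -> bnorm x <= r -> bnorm (f x) <= c * r.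
Proof.
  intros Hc Hf Hx; apply Rle_trans with (1 := Hf x), Rmult_le_compat_l; assumption.
Qed.

Lemma opnorm_le_weaken (X Y : Banach) (f : X -> Y) (c d : R) :
  c <= d -> opnorm_le f c -> opnorm_le f d.
Proof.
  intros Hcd Hf x; apply Rle_trans with (1 := Hf x), Rmult_le_compat_r; [apply bnorm_ge0|exact Hcd].
Qed.

Lemma bounded_linear_bound (X Y : Banach) (f : X -> Y) :
  bounded_linear f -> exists c, 0 <= c /\ opnorm_le f c.
Proof.
  intros [_ [c Hc]]; exists (Rabs c); split; [apply Rabs_pos|].
  apply opnorm_le_weaken with (2 := Hc), Rle_abs.
Qed.

(** Allowing a factor [c] spares rescaling the tolerance in limit arguments; the test value
    [(a - b) / (2 * (c + 1))] keeps [c * e] below half of [a - b]. *)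
Lemma le_of_le_plus_scaled (a b c : R) :
  0 <= c -> (forall e, 0 < e -> a <= b + c * e) -> a <= b.
Proof.
  intros Hc H; destruct (Rle_dec a b) as [|Hn]; [assumption|exfalso].
  assert (He : 0 < (a - b) / (2 * (c + 1))) by (apply Rdiv_lt_0_compat; lra).
  specialize (H _ He).
  assert (Hd : 2 * (c + 1) * ((a - b) / (2 * (c + 1))) = a - b) by (field; lra).
  nra.
Qed.

Lemma seq_lim_bnorm_le (X : Banach) (u : nat -> X) (l v : X) (c : R) (N : nat) :
  seq_lim u l -> (forall k, (N <= k)%nat -> bnorm (u k ⊖ v) <= c) -> bnorm (l ⊖ v) <= c.
Proof.
  intros Hu Hc; apply le_of_le_plus_scaled with 1; [lra|]; intros e He.
  destruct (Hu e He) as [N' HN'].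
  pose proof (HN' (max N N') ltac:(lia)) as H1.
  apply (bnorm_add2 X (l ⊖ u (max N N')) (u (max N N') ⊖ v) _ e c);
    [vec | rewrite bnorm_sub_sym; lra | apply Hc; lia | lra].
Qed.

(** * Real induction *)

(** Let [m] be the supremum of the times up to which [Q] holds throughout. The closing hypothesis
    gives [Q m], and the step hypothesis would carry [Q] past [m] if [m < b]. *)
Lemma real_induction (b : R) (Q : R -> Prop) :
  0 <= b -> Q 0 ->
  (forall s, 0 <= s < b -> Q s ->
     exists d, 0 < d /\ forall r, s < r < s + d -> r <= b -> Q r) ->
  (forall s, 0 < s <= b -> (forall r, 0 <= r < s -> Q r) -> Q s) ->
  Q b.
Proof.
  intros Hb H0 Hstep Hclose.
  set (E := fun s => 0 <= s <= b /\ forall r, 0 <= r <= s -> Q r).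
  assert (HE0 : E 0).
  { split; [lra|]; intros r Hr; replace r with 0 by lra; exact H0. }
  destruct (completeness E) as [m [Hub Hlub]].
  { exists b; intros s [Hs _]; lra. }
  { exists 0; exact HE0. }
  assert (Hm0 : 0 <= m) by apply Hub, HE0.
  assert (Hmb : m <= b) by (apply Hlub; intros s [Hs _]; lra).
  assert (Hlt : forall r, 0 <= r < m -> Q r).
  { intros r Hr; apply NNPP; intro Hn.
    enough (m <= r) by lra.
    apply Hlub; intros s [Hs HQ].
    destruct (Rle_dec s r); [assumption|exfalso; apply Hn, HQ; lra]. }
  assert (Hm : Q m).
  { destruct (Req_dec m 0) as [->|]; [exact H0|apply Hclose; [lra|exact Hlt]]. }
  destruct (Req_dec m b) as [<-|Hne]; [exact Hm|exfalso].
  destruct (Hstep m) as [d [Hd HQ]]; [lra|exact Hm|].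
  pose proof (Rmin_l (m + d / 2) b); pose proof (Rmin_r (m + d / 2) b).
  assert (m < Rmin (m + d / 2) b) by (apply Rmin_glb_lt; lra).
  enough (HE : E (Rmin (m + d / 2) b)) by (pose proof (Hub _ HE); lra).
  split; [lra|]; intros r Hr.
  destruct (Rlt_le_dec r m); [apply Hlt; lra|].
  destruct (Req_dec r m) as [->|]; [exact Hm|apply HQ; lra].
Qed.

Definition cont_nonneg {X : Banach} (f : R -> X) : Prop :=
  forall t0, 0 <= t0 -> forall eps, 0 < eps -> exists delta, 0 < delta /\
    forall t, 0 <= t -> Rabs (t - t0) < delta -> bnorm (f t ⊖ f t0) < eps.

(* Plays the role of uniform continuity of [f] on [0, b]: a property may be
   propagated along intervals on which [f] oscillates by at most [eps]. *)
Lemma cell_induction (X : Banach) (f : R -> X) (b eps : R) (Q : R -> Prop) :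
  cont_nonneg f -> 0 <= b -> 0 < eps -> Q 0 ->
  (forall r s, 0 <= r < s -> s <= b ->
     (forall q, r <= q <= s -> bnorm (f q ⊖ f r) <= eps) -> Q r -> Q s) ->
  Q b.
Proof.
  intros Hf Hb He H0 Hcell; apply real_induction; try assumption.
  - intros s Hs HQ; destruct (Hf s ltac:(lra) eps He) as [d [Hd Hd']].
    exists d; split; [exact Hd|]; intros r Hr Hrb.
    apply (Hcell s r); [lra|lra| |exact HQ]; intros q Hq.
    left; apply Hd'; [lra|]; apply Rabs_def1; lra.
  - intros s Hs HQ; destruct (Hf s ltac:(lra) (eps / 2) ltac:(lra)) as [d [Hd Hd']].
    pose proof (Rmax_l 0 (s - d / 2)); pose proof (Rmax_r 0 (s - d / 2)).
    assert (Rmax 0 (s - d / 2) < s) by (apply Rmax_lub_lt; lra).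
    set (r := Rmax 0 (s - d / 2)) in *.
    assert (Hnear : forall q, r <= q <= s -> bnorm (f q ⊖ f s) <= eps / 2).
    { intros q Hq; left; apply Hd'; [lra|]; apply Rabs_def1; lra. }
    apply (Hcell r s); [lra|lra| |apply HQ; lra]; intros q Hq.
    apply (bnorm_add2 X (f q ⊖ f s) (f s ⊖ f r) _ (eps / 2) (eps / 2));
      [vec|apply Hnear; lra|rewrite bnorm_sub_sym; apply Hnear; lra|lra].
Qed.

(** * Primitives of continuous functions *)

(* [F] integrates [f] over subintervals of [0, b] up to a relative error [eps]. *)
Definition approx_primitive {X : Banach} (f F : R -> X) (eps b : R) : Prop :=
  F 0 = bzero /\
  forall q r v c, 0 <= q <= r -> r <= b ->
    (forall p, q <= p <= r -> bnorm (f p ⊖ v) <= c) ->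
    bnorm (F r ⊖ F q ⊖ (r - q) ⊙ v) <= (c + eps) * (r - q).

(** Built cell by cell: on a new cell starting at [r0] the primitive is continued affinely with
    slope [f r0], as in a left Riemann sum. An interval straddling [r0] is split there. *)
Lemma approx_primitive_exists (X : Banach) (f : R -> X) (b eps : R) :
  cont_nonneg f -> 0 <= b -> 0 < eps -> exists F, approx_primitive f F eps b.
Proof.
  intros Hf Hb He; apply (cell_induction X f b eps (fun b => exists F, approx_primitive f F eps b));
    try assumption.
  - exists (fun _ => bzero); split; [reflexivity|]; intros q r v c Hq Hr _.
    replace (r - q) with 0 by lra.
    replace (bzero ⊖ bzero ⊖ 0 ⊙ v) with (bzero : X) by vec; rewrite bnorm_0; lra.
  - intros r0 s Hr Hs Hosc [F [F0 HF]].
    set (G := fun q => if Rle_dec q r0 then F q else F r0 ⊕ (q - r0) ⊙ f r0).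
    assert (GL : forall q, q <= r0 -> G q = F q).
    { intros q Hq; unfold G; destruct (Rle_dec q r0); [reflexivity|lra]. }
    assert (GR : forall q, r0 <= q -> G q = F r0 ⊕ (q - r0) ⊙ f r0).
    { intros q Hq; unfold G; destruct (Rle_dec q r0); [|reflexivity].
      replace q with r0 by lra; vec. }
    assert (Hright : forall q r v c, r0 <= q <= r -> r <= s ->
      (forall p, q <= p <= r -> bnorm (f p ⊖ v) <= c) ->
      bnorm (G r ⊖ G q ⊖ (r - q) ⊙ v) <= (c + eps) * (r - q)).
    { intros q r v c Hq Hrs Hv; rewrite !GR by lra.
      replace (F r0 ⊕ (r - r0) ⊙ f r0 ⊖ (F r0 ⊕ (q - r0) ⊙ f r0) ⊖ (r - q) ⊙ v)
        with ((r - q) ⊙ (f r0 ⊖ v)) by vec.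
      rewrite (Rmult_comm (c + eps)); apply bnorm_scal_le; [lra|].
      apply (bnorm_add2 X (f r0 ⊖ f q) (f q ⊖ v) _ eps c);
        [vec|rewrite bnorm_sub_sym; apply Hosc; lra|apply Hv; lra|lra]. }
    exists G; split; [rewrite GL by lra; exact F0|].
    intros q r v c Hq Hrs Hv.
    destruct (Rle_dec r r0) as [H1|H1].
    { rewrite !GL by lra; apply HF; [lra|lra|exact Hv]. }
    destruct (Rle_dec r0 q) as [H2|H2]; [apply Hright; [lra|lra|exact Hv]|].
    apply (bnorm_add2 X (G r ⊖ G r0 ⊖ (r - r0) ⊙ v) (G r0 ⊖ G q ⊖ (r0 - q) ⊙ v) _
      ((c + eps) * (r - r0)) ((c + eps) * (r0 - q))).
    + vec.
    + apply Hright; [lra|lra|]; intros; apply Hv; lra.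
    + rewrite !GL by lra; apply HF; [lra|lra|]; intros; apply Hv; lra.
    + lra.
Qed.

(** Over a cell starting at [q] both increments are close to [(r - q) ⊙ f q], so the difference
    grows at a rate of at most [e + e'] plus twice the oscillation [d], which is arbitrary. *)
Lemma approx_primitive_close (X : Banach) (f F G : R -> X) (e e' b s : R) :
  cont_nonneg f -> approx_primitive f F e b -> approx_primitive f G e' b -> 0 <= s <= b ->
  bnorm (F s ⊖ G s) <= (e + e') * s.
Proof.
  intros Hf [F0 HF] [G0 HG] Hs; apply le_of_le_plus_scaled with (2 * s); [lra|].
  intros d Hd; replace ((e + e') * s + 2 * s * d) with ((e + e' + 2 * d) * s) by ring.
  apply (cell_induction X f s d (fun s => bnorm (F s ⊖ G s) <= (e + e' + 2 * d) * s));
    [exact Hf|lra|exact Hd| |].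
  - rewrite F0, G0; replace (bzero ⊖ bzero) with (bzero : X) by vec; rewrite bnorm_0; lra.
  - intros q r Hq Hr Hosc IH.
    apply (bnorm_add3 X (F q ⊖ G q) (F r ⊖ F q ⊖ (r - q) ⊙ f q) (bopp (G r ⊖ G q ⊖ (r - q) ⊙ f q)) _
      ((e + e' + 2 * d) * q) ((d + e) * (r - q)) ((d + e') * (r - q))).
    + vec.
    + exact IH.
    + apply HF; [lra|lra|exact Hosc].
    + rewrite bnorm_opp; apply HG; [lra|lra|exact Hosc].
    + lra.
Qed.

Lemma inv_INR_S_pos (k : nat) : 0 < / (INR k + 1).
Proof. apply Rinv_0_lt_compat; pose proof (pos_INR k); lra. Qed.

Lemma inv_INR_S_small (e : R) : 0 < e -> exists N, forall k, (N <= k)%nat -> / (INR k + 1) <= e.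
Proof.
  intro He; destruct (INR_unbounded (/ e)) as [N HN]; exists N; intros k Hk.
  apply le_INR in Hk; rewrite <- (Rinv_inv e).
  apply Rinv_le_contravar; [apply Rinv_0_lt_compat; lra|lra].
Qed.

(** Approximate primitives with errors [/ (INR k + 1)] form a Cauchy sequence at each time by
    [approx_primitive_close]; the estimate passes to their limit with error 0. *)
Lemma primitive_exists (X : Banach) (f : R -> X) (b : R) :
  cont_nonneg f -> 0 <= b -> exists F, approx_primitive f F 0 b.
Proof.
  intros Hf Hb.
  destruct (choice (fun (k : nat) F => approx_primitive f F (/ (INR k + 1)) b)) as [Fk HFk].
  { intro k; apply approx_primitive_exists; [exact Hf|exact Hb|apply inv_INR_S_pos]. }
  assert (Hlim : forall s, exists l : X, 0 <= s <= b -> seq_lim (fun k => Fk k s) l).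
  { intro s; destruct (classic (0 <= s <= b)) as [Hs|Hs]; [|exists bzero; tauto].
    destruct (bcomplete X (fun k => Fk k s)) as [l Hl]; [|exists l; intros _; exact Hl].
    intros e He; destruct (inv_INR_S_small (e / (4 * (b + 1)))) as [N HN].
    { apply Rdiv_lt_0_compat; lra. }
    exists N; intros p q Hp Hq.
    apply Rle_lt_trans with (1 := approx_primitive_close X f _ _ _ _ b s Hf (HFk p) (HFk q) Hs).
    pose proof (HN p Hp); pose proof (HN q Hq); pose proof (inv_INR_S_pos p);
      pose proof (inv_INR_S_pos q).
    apply Rle_lt_trans with (2 * (e / (4 * (b + 1))) * (b + 1)).
    - apply Rmult_le_compat; lra.
    - replace (2 * (e / (4 * (b + 1))) * (b + 1)) with (e / 2) by (field; lra); lra. }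
  destruct (choice _ Hlim) as [F HF]; exists F; split.
  - apply bsub_eq0, bnorm_eq0, Rle_antisym; [|apply bnorm_ge0].
    apply (seq_lim_bnorm_le X (fun k => Fk k 0) _ _ _ 0); [apply HF; lra|].
    intros k _; rewrite (proj1 (HFk k)).
    replace (bzero ⊖ bzero) with (bzero : X) by vec; rewrite bnorm_0; lra.
  - intros q r v c Hq Hr Hv; apply le_of_le_plus_scaled with (r - q + 2); [lra|]; intros e He.
    destruct (inv_INR_S_small e He) as [N HN].
    destruct (HF q ltac:(lra) e He) as [N1 HN1], (HF r ltac:(lra) e He) as [N2 HN2].
    set (k := max N (max N1 N2)).
    pose proof (HN k ltac:(lia)); pose proof (HN1 k ltac:(lia)); pose proof (HN2 k ltac:(lia)).
    pose proof (proj2 (HFk k) q r v c Hq Hr Hv).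
    apply (bnorm_add3 X (bopp (Fk k r ⊖ F r)) (Fk k q ⊖ F q) (Fk k r ⊖ Fk k q ⊖ (r - q) ⊙ v) _
      e e ((c + e) * (r - q))).
    + vec.
    + rewrite bnorm_opp; lra.
    + lra.
    + apply Rle_trans with (1 := H2), Rmult_le_compat_r; lra.
    + lra.
Qed.

(** * Semigroups and their generators *)

Lemma C0_cont (X : Banach) (T : R -> X -> X) (x : X) :
  C0_semigroup T -> cont_nonneg (fun s => T s x).
Proof. intros [_ [_ [_ H]]]; exact (H x). Qed.

(** The averages [/ s ⊙ F s] of an orbit over [[0, s]] lie in the domain, with image
    [/ s ⊙ (T s x ⊖ x)], and tend to [x] as [s] tends to 0. *)
Lemma generator_dense (X : Banach) (D : X -> Prop) (A : X -> X) (T : R -> X -> X) :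
  generates D A T -> densely_defined D.
Proof.
  intros [HT Hgen] x e He.
  pose proof (C0_cont X T x HT) as Hcont.
  destruct HT as [Hbl [HT0 [HTadd _]]].
  destruct (primitive_exists X (fun s => T s x) 2 Hcont ltac:(lra)) as [F [F0 HF]].
  destruct (Hcont 0 ltac:(lra) (e / 2) ltac:(lra)) as [d [Hd Hd']].
  (* With [s <= 1] and [r <= 1] the time [r + s] stays in [[0, 2]], where [F] is a primitive;
     [s < d] makes the average close to [x]. *)
  set (s := Rmin 1 (d / 2)).
  assert (Hs : 0 < s) by (apply Rmin_pos; lra).
  assert (Hs1 : s <= 1) by apply Rmin_l.
  assert (Hsd : s < d) by (pose proof (Rmin_r 1 (d / 2)); unfold s; lra).
  (* [T r] may be taken inside the integral: on each cell both sides grow by approximately the cell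
     length times [T (r + p) x]. *)
  assert (Hshift : forall r, 0 < r <= 1 -> T r (F s) = F (r + s) ⊖ F r).
  { intros r Hr.
    destruct (bounded_linear_bound _ _ _ (Hbl r ltac:(lra))) as [C [HC HCn]].
    pose proof (proj1 (Hbl r ltac:(lra))) as Hlin.
    apply bsub_eq0, bnorm_eq0, Rle_antisym; [|apply bnorm_ge0].
    apply le_of_le_plus_scaled with (2 * C * s); [apply Rmult_le_pos; lra|]; intros c Hc.
    replace (0 + 2 * C * s * c) with (2 * C * c * s) by ring.
    apply (cell_induction X (fun s => T s x) s c
      (fun s => bnorm (T r (F s) ⊖ (F (r + s) ⊖ F r)) <= 2 * C * c * s));
      [exact Hcont|lra|exact Hc| |].
    - rewrite F0, is_linear_0, Rplus_0_r by exact Hlin.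
      replace (bzero ⊖ (F r ⊖ F r)) with (bzero : X) by vec; rewrite bnorm_0; lra.
    - intros p q Hp Hq Hosc IH.
      apply (bnorm_add3 X (T r (F p) ⊖ (F (r + p) ⊖ F r))
        (T r (F q ⊖ F p ⊖ (q - p) ⊙ T p x))
        (bopp (F (r + q) ⊖ F (r + p) ⊖ ((r + q) - (r + p)) ⊙ T (r + p) x)) _
        (2 * C * c * p) (C * ((c + 0) * (q - p))) ((C * c + 0) * ((r + q) - (r + p)))).
      + rewrite !(is_linear_sub _ _ _ _ _ Hlin), (proj2 Hlin), HTadd by lra; vec.
      + exact IH.
      + apply opnorm_bound; [exact HC|exact HCn|]; apply HF; [lra|lra|exact Hosc].
      + rewrite bnorm_opp; apply HF; [lra|lra|]; intros z Hz.
        replace z with (r + (z - r)) by ring; rewrite !HTadd by lra.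
        rewrite <- is_linear_sub by exact Hlin.
        apply opnorm_bound; [exact HC|exact HCn|]; apply Hosc; lra.
      + lra. }
  exists (/ s ⊙ F s); split.
  - enough (H : lim_0plus (fun h => / h ⊙ (T h (/ s ⊙ F s) ⊖ / s ⊙ F s)) (/ s ⊙ (T s x ⊖ x)))
      by exact (proj1 (proj2 (Hgen _ _) H)).
    intros c Hc.
    assert (Hcs : 0 < c * s / 4) by nra.
    destruct (Hcont s ltac:(lra) _ Hcs) as [d1 [Hd1 Hd1']].
    destruct (Hcont 0 ltac:(lra) _ Hcs) as [d2 [Hd2 Hd2']].
    exists (Rmin 1 (Rmin d1 d2)); split; [repeat apply Rmin_pos; lra|]; intros h Hh Hhd.
    assert (h <= 1 /\ h < d1 /\ h < d2) as [Hh1 [Hh2 Hh3]].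
    { pose proof (Rmin_l 1 (Rmin d1 d2)); pose proof (Rmin_r 1 (Rmin d1 d2)).
      pose proof (Rmin_l d1 d2); pose proof (Rmin_r d1 d2); lra. }
    rewrite (proj2 (proj1 (Hbl h ltac:(lra)))), Hshift by lra.
    (* The quotient compares the integrals of the orbit over [[s, h + s]] and [[0, h]], where the
       orbit is near [T s x] and [T 0 x] respectively. *)
    replace (/ h ⊙ (/ s ⊙ (F (h + s) ⊖ F h) ⊖ / s ⊙ F s) ⊖ / s ⊙ (T s x ⊖ x)) with
      ((/ h * / s) ⊙ ((F (h + s) ⊖ F s ⊖ ((h + s) - s) ⊙ T s x)
                      ⊖ (F h ⊖ F 0 ⊖ (h - 0) ⊙ T 0 x))) by (rewrite F0, HT0; vec).
    apply Rle_lt_trans with (/ h * / s * (c * s / 2 * h)).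
    + apply bnorm_scal_le.
      { apply Rmult_le_pos; left; apply Rinv_0_lt_compat; lra. }
      apply (bnorm_add2 X (F (h + s) ⊖ F s ⊖ ((h + s) - s) ⊙ T s x)
        (bopp (F h ⊖ F 0 ⊖ (h - 0) ⊙ T 0 x)) _
        ((c * s / 4 + 0) * ((h + s) - s)) ((c * s / 4 + 0) * (h - 0))).
      * vec.
      * apply HF; [lra|lra|]; intros p Hp; left; apply Hd1'; [lra|apply Rabs_def1; lra].
      * rewrite bnorm_opp; apply HF; [lra|lra|]; intros p Hp; left; apply Hd2';
          [lra|apply Rabs_def1; lra].
      * lra.
    + replace (/ h * / s * (c * s / 2 * h)) with (c / 2) by (field; lra); lra.
  - replace (x ⊖ / s ⊙ F s) with (/ s ⊙ (bopp (F s ⊖ F 0 ⊖ (s - 0) ⊙ T 0 x)))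
      by (rewrite F0, HT0; vec).
    apply Rle_lt_trans with (/ s * ((e / 2 + 0) * (s - 0))).
    + apply bnorm_scal_le; [left; apply Rinv_0_lt_compat; lra|].
      rewrite bnorm_opp; apply HF; [lra|lra|]; intros p Hp; left; apply Hd';
        [lra|apply Rabs_def1; lra].
    + replace (/ s * ((e / 2 + 0) * (s - 0))) with (e / 2) by (field; lra); lra.
Qed.

(** Division by [K + 1] covers [K = 0]. *)
Lemma eps_scale (K e : R) : 0 <= K -> 0 < e -> exists e', 0 < e' /\ K * e' <= e.
Proof.
  intros HK He; exists (e / (K + 1)).
  assert (H : 0 < e / (K + 1)) by (apply Rdiv_lt_0_compat; lra).
  split; [exact H|].
  assert (e / (K + 1) * (K + 1) = e) by (field; lra); lra.
Qed.

(* Mean value inequality for the orbit of [x], whose right derivative at [s] is [T s (A x)]. *)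
Lemma generator_increment (X : Banach) (D : X -> Prop) (A : X -> X) (T : R -> X -> X)
  (x z : X) (c h : R) :
  generates D A T -> D x -> 0 <= h ->
  (forall s, 0 <= s < h -> bnorm (T s (A x) ⊖ z) <= c) ->
  bnorm (T h x ⊖ x ⊖ h ⊙ z) <= c * h.
Proof.
  intros [HT Hgen] Dx Hh Hc.
  pose proof (proj1 (Hgen x (A x)) (conj Dx eq_refl)) as Hder.
  pose proof (C0_cont X T x HT) as Hcont.
  destruct HT as [Hbl [HT0 [HTadd _]]].
  apply le_of_le_plus_scaled with h; [exact Hh|]; intros e He.
  replace (c * h + h * e) with ((c + e) * h) by ring.
  apply (real_induction h (fun s => bnorm (T s x ⊖ x ⊖ s ⊙ z) <= (c + e) * s)); [exact Hh| | |].
  - rewrite HT0; replace (x ⊖ x ⊖ 0 ⊙ z) with (bzero : X) by vec; rewrite bnorm_0; lra.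
  - intros s Hs IH.
    destruct (bounded_linear_bound _ _ _ (Hbl s ltac:(lra))) as [C [HC HCn]].
    pose proof (proj1 (Hbl s ltac:(lra))) as Hlin.
    destruct (eps_scale C e HC He) as [e' [He' HCe]].
    destruct (Hder e' He') as [d [Hd Hd']].
    exists d; split; [exact Hd|]; intros r Hr Hrh.
    set (k := r - s).
    assert (Hk : 0 < k) by (unfold k; lra).
    replace r with (s + k) by (unfold k; ring).
    (* The increment after [s] is [T s] applied to that of [x], whose quotient is near [A x]; then
       [T s (A x)] is compared with [z]. *)
    apply (bnorm_add3 X (T s x ⊖ x ⊖ s ⊙ z) (k ⊙ T s (/ k ⊙ (T k x ⊖ x) ⊖ A x))
      (k ⊙ (T s (A x) ⊖ z)) _ ((c + e) * s) (k * e) (k * c)).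
    + rewrite (is_linear_sub _ _ _ _ _ Hlin), (proj2 Hlin), (is_linear_sub _ _ _ _ _ Hlin),
        HTadd by lra; vec.
    + exact IH.
    + apply bnorm_scal_le; [lra|]; apply Rle_trans with (2 := HCe).
      apply opnorm_bound; [exact HC|exact HCn|]; left; apply Hd'; unfold k; lra.
    + apply bnorm_scal_le; [lra|]; apply Hc; lra.
    + lra.
  - intros s Hs IH.
    (* The sign of [c] serves to pass from [(c + e) * r] to [(c + e) * s]. *)
    assert (Hc0 : 0 <= c).
    { apply Rle_trans with (bnorm (T 0 (A x) ⊖ z)); [apply bnorm_ge0|apply Hc; lra]. }
    apply le_of_le_plus_scaled with 2; [lra|]; intros e' He'.
    destruct (Hcont s ltac:(lra) e' He') as [d [Hd Hd']].
    destruct (eps_scale (bnorm z) e' (bnorm_ge0 X z) He') as [d' [Hd1 Hd2]].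
    set (r := Rmax 0 (s - Rmin (d / 2) d')).
    pose proof (Rmin_l (d / 2) d'); pose proof (Rmin_r (d / 2) d').
    assert (0 < Rmin (d / 2) d') by (apply Rmin_pos; lra).
    assert (0 <= r) by apply Rmax_l.
    assert (s - Rmin (d / 2) d' <= r) by apply Rmax_r.
    assert (r < s) by (apply Rmax_lub_lt; lra).
    apply (bnorm_add3 X (T r x ⊖ x ⊖ r ⊙ z) (bopp (T r x ⊖ T s x)) (bopp ((s - r) ⊙ z)) _
      ((c + e) * r) e' e').
    + vec.
    + apply IH; lra.
    + rewrite bnorm_opp; left; apply Hd'; [lra|apply Rabs_def1; lra].
    + rewrite bnorm_opp, bnorm_scal, Rabs_right by lra.
      pose proof (bnorm_ge0 X z); nra.
    + nra.
Qed.

(** [T h] and [T s] commute, so the difference quotient of [T s x] is [T s] applied to that of [x],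
    and [T s] is bounded. *)
Lemma generator_orbit (X : Banach) (D : X -> Prop) (A : X -> X) (T : R -> X -> X) (x : X) (s : R) :
  generates D A T -> D x -> 0 <= s -> D (T s x) /\ A (T s x) = T s (A x).
Proof.
  intros [[Hbl [_ [HTadd _]]] Hgen] Dx Hs; apply Hgen.
  pose proof (proj1 (Hgen x (A x)) (conj Dx eq_refl)) as Hder.
  destruct (bounded_linear_bound _ _ _ (Hbl s Hs)) as [C [HC HCn]].
  pose proof (proj1 (Hbl s Hs)) as Hlin.
  intros e He; destruct (eps_scale C (e / 2) HC ltac:(lra)) as [e' [He' HCe]].
  destruct (Hder e' He') as [d [Hd Hd']].
  exists d; split; [exact Hd|]; intros h Hh Hhd.
  rewrite <- HTadd, Rplus_comm, HTadd, <- is_linear_sub, <- (proj2 Hlin), <- is_linear_sub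
    by (exact Hlin || lra).
  apply Rle_lt_trans with (C * e'); [|lra].
  apply opnorm_bound; [exact HC|exact HCn|]; left; apply Hd'; assumption.
Qed.

(** * Consistency *)

(** A filter for [h] to 0 from the right jointly with [m] to infinity; [d <= 1] keeps [h] where the
    growth bounds can be replaced by constants. *)
Definition eventually (Q : R -> nat -> Prop) : Prop :=
  exists d N, 0 < d <= 1 /\ forall h m, 0 < h < d -> (N <= m)%nat -> Q h m.

Lemma eventually_and (Q1 Q2 : R -> nat -> Prop) :
  eventually Q1 -> eventually Q2 -> eventually (fun h m => Q1 h m /\ Q2 h m).
Proof.
  intros [d1 [N1 [Hd1 H1]]] [d2 [N2 [Hd2 H2]]].
  pose proof (Rmin_l d1 d2); pose proof (Rmin_r d1 d2).
  exists (Rmin d1 d2), (max N1 N2); split; [split; [apply Rmin_pos|]; lra|].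
  intros h m Hh Hm; split; [apply H1|apply H2]; lra || lia.
Qed.

Lemma eventually_mono (Q1 Q2 : R -> nat -> Prop) :
  eventually Q1 -> (forall h m, 0 < h <= 1 -> Q1 h m -> Q2 h m) -> eventually Q2.
Proof.
  intros [d [N [Hd H1]]] H12; exists d, N; split; [exact Hd|].
  intros h m Hh Hm; apply H12; [lra|apply H1; assumption].
Qed.

Lemma eventually_small (d : R) : 0 < d -> eventually (fun h _ => h < d).
Proof.
  intro Hd; exists (Rmin 1 d), 0%nat; split; [split; [apply Rmin_pos; lra|apply Rmin_l]|].
  intros h _ Hh _; pose proof (Rmin_r 1 d); lra.
Qed.

Lemma eventually_large (N : nat) : eventually (fun _ m => (N <= m)%nat).
Proof. exists 1, N; split; [lra|]; intros; assumption. Qed.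

(** Estimates may be proved up to a constant factor [K] and normalised afterwards. *)
Lemma eventually_scale (f g : R -> nat -> R) (K e : R) :
  0 <= K -> 0 < e -> (forall h m, 0 < h -> 0 <= g h m) ->
  (forall e, 0 < e -> eventually (fun h m => f h m <= K * e * g h m)) ->
  eventually (fun h m => f h m <= e * g h m).
Proof.
  intros HK He Hg H; destruct (eps_scale K e HK He) as [e' [He' HKe]].
  apply eventually_mono with (1 := H e' He'); intros h m Hh Hf.
  apply Rle_trans with (1 := Hf), Rmult_le_compat_r; [apply Hg; lra|exact HKe].
Qed.

Definition approx_scheme {X : Banach} {Xm : nat -> Banach}
  (P : forall m, X -> Xm m) (J : forall m, Xm m -> X) (c : R) : Prop :=
  0 <= c /\ (forall m, is_linear (P m)) /\ (forall m, opnorm_le (P m) c) /\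
  (forall m y, P m (J m y) = y).

(** Stated for one operator, so that the same lemmas serve [A] and [B]. The constant [C] replaces
    the exponential bound for [h <= 1]. *)
Definition consistent_family {X : Banach} {Xm : nat -> Banach}
  (P : forall m, X -> Xm m) (J : forall m, Xm m -> X)
  (D : X -> Prop) (A : X -> X) (Dm : forall m, Xm m -> Prop) (Am : forall m, Xm m -> Xm m)
  (Tm : forall m, R -> Xm m -> Xm m) (C : R) : Prop :=
  densely_defined D /\ (forall m, generates (Dm m) (Am m) (Tm m)) /\
  1 <= C /\ (forall h m, 0 < h <= 1 -> opnorm_le (Tm m h) C) /\
  (forall x, D x -> (forall m, Dm m (P m x)) /\ seq_lim (fun m => J m (Am m (P m x))) (A x)).

Lemma generates_linear (X : Banach) (D : X -> Prop) (A : X -> X) (T : R -> X -> X) (h : R) :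
  generates D A T -> 0 <= h -> is_linear (T h).
Proof. intros [[Hbl _] _] Hh; apply (Hbl h Hh). Qed.

Lemma generates_0 (X : Banach) (D : X -> Prop) (A : X -> X) (T : R -> X -> X) (x : X) :
  generates D A T -> T 0 x = x.
Proof. intros [[_ [H _]] _]; apply H. Qed.

Section Consistency.

Context {X : Banach} {Xm : nat -> Banach}
  {P : forall m, X -> Xm m} {J : forall m, Xm m -> X} {c : R} (HP : approx_scheme P J c).

(** Applying [P m] to [J m (Am m (P m y)) ⊖ A y] and using [P m (J m z) = z] moves the consistency
    condition into [Xm m]. *)
Lemma generator_consistent (D : X -> Prop) (A : X -> X) (Dm : forall m, Xm m -> Prop)
  (Am : forall m, Xm m -> Xm m) (Tm : forall m, R -> Xm m -> Xm m) (C : R) (y : X) (e : R) :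
  consistent_family P J D A Dm Am Tm C -> D y -> 0 < e ->
  eventually (fun _ m => bnorm (Am m (P m y) ⊖ P m (A y)) <= e).
Proof.
  destruct HP as [Hc [HPl [HPn HPJ]]]; intros [_ [_ [_ [_ Hcons]]]] Dy He.
  destruct (eps_scale c e Hc He) as [e' [He' Hce]].
  destruct (proj2 (Hcons y Dy) e' He') as [N HN].
  apply eventually_mono with (1 := eventually_large N); intros _ m _ Hm.
  rewrite <- (HPJ m (Am m (P m y))), <- is_linear_sub by apply HPl.
  apply Rle_trans with (2 := Hce), opnorm_bound; [exact Hc|apply HPn|].
  left; apply HN, Hm.
Qed.

Lemma opnorm_le_family (D : X -> Prop) (A : X -> X) (Dm : forall m, Xm m -> Prop)
  (Am : forall m, Xm m -> Xm m) (Tm : forall m, R -> Xm m -> Xm m) (C h r : R) (m : nat)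
  (y : Xm m) :
  consistent_family P J D A Dm Am Tm C -> 0 <= h <= 1 -> bnorm y <= r ->
  bnorm (Tm m h y) <= C * r.
Proof.
  intros [_ [Hgen [HC [Hst _]]]] Hh Hy; pose proof (bnorm_ge0 _ y).
  destruct (Req_dec h 0) as [->|].
  - rewrite (generates_0 _ _ _ _ _ (Hgen m)); nra.
  - apply opnorm_bound; [lra|apply Hst; lra|exact Hy].
Qed.

(** Strong continuity at 0, uniform in large [m]: for [y] in the domain [Am m (P m y)] stays bounded
    for large [m], so the orbit moves by O(h); density and the uniform bound extend this to all
    [z]. *)
Lemma family_cont_0 (D : X -> Prop) (A : X -> X) (Dm : forall m, Xm m -> Prop)
  (Am : forall m, Xm m -> Xm m) (Tm : forall m, R -> Xm m -> Xm m) (C : R) (z : X) (e : R) :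
  consistent_family P J D A Dm Am Tm C -> 0 < e ->
  eventually (fun h m => bnorm (Tm m h (P m z) ⊖ P m z) <= e).
Proof.
  intros HF He; pose proof HF as [Hdense [Hgen [HC [Hst Hcons]]]].
  pose proof HP as [Hc [HPl [HPn HPJ]]].
  enough (eventually (fun h m => bnorm (Tm m h (P m z) ⊖ P m z) <= e * 1)) as H.
  { apply eventually_mono with (1 := H); intros; lra. }
  assert (HK : 0 <= C * c + c + 1) by nra.
  apply eventually_scale with (C * c + c + 1); [exact HK|exact He|intros; lra|].
  clear e He; intros e He.
  destruct (Hdense z e He) as [y [Dy Hy]].
  pose proof (bnorm_ge0 _ (A y)).
  set (b := c * bnorm (A y) + 1).
  assert (Hb : 0 <= C * b) by (apply Rmult_le_pos; [lra|unfold b; nra]).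
  destruct (eps_scale (C * b) e Hb He) as [d [Hd Hde]].
  apply eventually_mono with (1 := eventually_and _ _ (eventually_small d Hd)
    (generator_consistent _ _ _ _ _ _ y 1 HF Dy ltac:(lra))).
  intros h m Hh [Hhd Hm].
  pose proof (generates_linear _ _ _ _ h (Hgen m) ltac:(lra)) as HTl.
  assert (HA : bnorm (Am m (P m y)) <= b).
  { apply (bnorm_add2 _ (Am m (P m y) ⊖ P m (A y)) (P m (A y)) _ 1 (c * bnorm (A y)));
      [vec|exact Hm|apply HPn|unfold b; lra]. }
  assert (Hinc : bnorm (Tm m h (P m y) ⊖ P m y ⊖ h ⊙ bzero) <= C * b * h).
  { apply (generator_increment _ _ _ _ _ _ _ _ (Hgen m)); [apply Hcons, Dy|lra|].
    intros s Hs; replace (Tm m s (Am m (P m y)) ⊖ bzero) with (Tm m s (Am m (P m y))) by vec.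
    apply (opnorm_le_family _ _ _ _ _ _ _ _ _ _ HF); [lra|exact HA]. }
  assert (HPzy : bnorm (P m (z ⊖ y)) <= c * e) by (apply opnorm_bound; [exact Hc|apply HPn|lra]).
  apply (bnorm_add3 _ (Tm m h (P m (z ⊖ y))) (Tm m h (P m y) ⊖ P m y ⊖ h ⊙ bzero)
    (bopp (P m (z ⊖ y))) _ (C * (c * e)) e (c * e)).
  - rewrite (is_linear_sub _ _ (P m)), (is_linear_sub _ _ (Tm m h)) by (apply HPl || exact HTl).
    vec.
  - apply (opnorm_le_family _ _ _ _ _ _ _ _ _ _ HF); [lra|exact HPzy].
  - nra.
  - rewrite bnorm_opp; exact HPzy.
  - lra.
Qed.

(** The derivative [Tm m s (Am m (P m y))] of the orbit is close to [P m (A y)], by consistency and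
    by [family_cont_0] at [A y]; the mean value inequality then gives the increment. *)
Lemma family_derivative (D : X -> Prop) (A : X -> X) (Dm : forall m, Xm m -> Prop)
  (Am : forall m, Xm m -> Xm m) (Tm : forall m, R -> Xm m -> Xm m) (C : R) (y : X) (e : R) :
  consistent_family P J D A Dm Am Tm C -> D y -> 0 < e ->
  eventually (fun h m => bnorm (Tm m h (P m y) ⊖ P m y ⊖ h ⊙ P m (A y)) <= e * h).
Proof.
  intros HF Dy He; pose proof HF as [_ [Hgen [HC [_ Hcons]]]].
  apply eventually_scale with (C + 1); [lra|exact He|intros; lra|].
  clear e He; intros e He.
  (* The thresholds are unpacked because the bound is used at every [s < h], not only at [h]. *)
  destruct (family_cont_0 _ _ _ _ _ _ (A y) e HF He) as [d [N [Hd HN]]].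
  apply eventually_mono with (1 := eventually_and _ _ (eventually_small d (proj1 Hd))
    (eventually_and _ _ (eventually_large N) (generator_consistent _ _ _ _ _ _ y e HF Dy He))).
  intros h m Hh [Hhd [Hm HA]].
  apply (generator_increment _ _ _ _ _ _ _ _ (Hgen m)); [apply Hcons, Dy|lra|].
  intros s Hs.
  pose proof (generates_linear _ _ _ _ s (Hgen m) ltac:(lra)) as HTl.
  apply (bnorm_add2 _ (Tm m s (Am m (P m y) ⊖ P m (A y)))
    (Tm m s (P m (A y)) ⊖ P m (A y)) _ (C * e) e).
  - rewrite (is_linear_sub _ _ _ _ _ HTl); vec.
  - apply (opnorm_le_family _ _ _ _ _ _ _ _ _ _ HF); [lra|exact HA].
  - destruct (Req_dec s 0) as [->|].
    + rewrite (generates_0 _ _ _ _ _ (Hgen m)).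
      replace (P m (A y) ⊖ P m (A y)) with (bzero : Xm m) by vec; rewrite bnorm_0; lra.
    + apply HN; [lra|exact Hm].
  - lra.
Qed.

(** Apply [Sm m h] to the error of [Tm m h] and add the error of [Sm m h]. What remains is
    [h ⊙ (Sm m h (P m (A y)) ⊖ P m (A y))], which is o(h) although [A y] need not lie in [DB], since
    [family_cont_0] holds for all vectors. *)
Lemma product_derivative (DA DB : X -> Prop) (A B : X -> X) (DAm DBm : forall m, Xm m -> Prop)
  (Am Bm : forall m, Xm m -> Xm m) (Tm Sm : forall m, R -> Xm m -> Xm m) (CT CS : R)
  (y : X) (e : R) :
  consistent_family P J DA A DAm Am Tm CT -> consistent_family P J DB B DBm Bm Sm CS ->
  DA y -> DB y -> 0 < e ->
  eventually (fun h m =>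
    bnorm (Sm m h (Tm m h (P m y)) ⊖ P m y ⊖ h ⊙ P m (A y ⊕ B y)) <= e * h).
Proof.
  intros HA HB Ay By He; pose proof HB as [_ [Hgen [HC _]]].
  pose proof HP as [_ [HPl _]].
  apply eventually_scale with (CS + 2); [lra|exact He|intros; lra|].
  clear e He; intros e He.
  apply eventually_mono with (1 := eventually_and _ _
    (family_derivative _ _ _ _ _ _ y e HA Ay He)
    (eventually_and _ _ (family_derivative _ _ _ _ _ _ y e HB By He)
      (family_cont_0 _ _ _ _ _ _ (A y) e HB He))).
  intros h m Hh [H1 [H2 H3]].
  pose proof (generates_linear _ _ _ _ h (Hgen m) ltac:(lra)) as HSl.
  apply (bnorm_add3 _ (Sm m h (Tm m h (P m y) ⊖ P m y ⊖ h ⊙ P m (A y)))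
    (Sm m h (P m y) ⊖ P m y ⊖ h ⊙ P m (B y)) (h ⊙ (Sm m h (P m (A y)) ⊖ P m (A y))) _
    (CS * (e * h)) (e * h) (h * e)).
  - rewrite !(is_linear_sub _ _ _ _ _ HSl), (proj2 HSl), (proj1 (HPl m)); vec.
  - apply (opnorm_le_family _ _ _ _ _ _ _ _ _ _ HB); [lra|exact H1].
  - exact H2.
  - apply bnorm_scal_le; [lra|exact H3].
  - lra.
Qed.

(** Both orders of the product have the same first-order term, and the weights sum to 1. *)
Lemma weighted_derivative (DA DB : X -> Prop) (A B : X -> X) (DAm DBm : forall m, Xm m -> Prop)
  (Am Bm : forall m, Xm m -> Xm m) (Tm Sm : forall m, R -> Xm m -> Xm m) (CT CS Theta : R)
  (y : X) (e : R) :
  consistent_family P J DA A DAm Am Tm CT -> consistent_family P J DB B DBm Bm Sm CS ->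
  0 <= Theta <= 1 -> DA y -> DB y -> 0 < e ->
  eventually (fun h m =>
    bnorm (weighted_op Theta (Sm m) (Tm m) h (P m y) ⊖ P m y ⊖ h ⊙ P m (A y ⊕ B y)) <= e * h).
Proof.
  intros HA HB HTh Ay By He.
  apply eventually_mono with (1 := eventually_and _ _
    (product_derivative _ _ _ _ _ _ _ _ _ _ _ _ y e HA HB Ay By He)
    (product_derivative _ _ _ _ _ _ _ _ _ _ _ _ y e HB HA By Ay He)).
  intros h m Hh [H1 H2]; rewrite (badd_comm _ (B y)) in H2; unfold weighted_op.
  apply (bnorm_add2 _ (Theta ⊙ (Sm m h (Tm m h (P m y)) ⊖ P m y ⊖ h ⊙ P m (A y ⊕ B y)))
    ((1 - Theta) ⊙ (Tm m h (Sm m h (P m y)) ⊖ P m y ⊖ h ⊙ P m (A y ⊕ B y))) _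
    (Theta * (e * h)) ((1 - Theta) * (e * h))).
  - vec.
  - apply bnorm_scal_le; [lra|exact H1].
  - apply bnorm_scal_le; [lra|exact H2].
  - lra.
Qed.

End Consistency.

(** * Convergence of stable and consistent iterations *)

Lemma iter_linear (Y : Banach) (V : Y -> Y) (k : nat) :
  is_linear V -> is_linear (Nat.iter k V).
Proof.
  intros [Ha Hs]; induction k as [|k [IHa IHs]]; split; intros; simpl; try reflexivity.
  - rewrite IHa; apply Ha.
  - rewrite IHs; apply Hs.
Qed.

Lemma weighted_op_linear (Y : Banach) (Theta : R) (S T : R -> Y -> Y) (h : R) :
  is_linear (S h) -> is_linear (T h) -> is_linear (weighted_op Theta S T h).
Proof.
  intros [Sa Ss] [Ta Ts]; split; intros; unfold weighted_op.
  - rewrite Ta, Sa, Sa, Ta; vec.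
  - rewrite Ts, Ss, Ss, Ts; vec.
Qed.

(** The difference is the sum over [a < i] of the defects [V (z a) ⊖ z (S a)] propagated by the
    later steps; the extra power [l] lets the induction hypothesis be applied with one more factor
    [V] in front. *)
Lemma iter_telescope (Y : Banach) (V : Y -> Y) (K e : R) (n : nat) (z : nat -> Y) :
  is_linear V -> 0 <= K -> (forall k, (k <= n)%nat -> opnorm_le (Nat.iter k V) K) ->
  forall i l, (l + i <= n)%nat ->
  (forall a, (a < i)%nat -> bnorm (V (z a) ⊖ z (S a)) <= e) ->
  bnorm (Nat.iter l V (Nat.iter i V (z 0%nat) ⊖ z i)) <= K * e * INR i.
Proof.
  intros HV HK Hst; induction i as [|i IH]; intros l Hl Hz.
  - simpl Nat.iter; replace (z 0%nat ⊖ z 0%nat) with (bzero : Y) by vec.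
    rewrite is_linear_0 by (apply iter_linear, HV).
    rewrite bnorm_0; simpl INR; lra.
  - apply (bnorm_add2 _ (Nat.iter (S l) V (Nat.iter i V (z 0%nat) ⊖ z i))
      (Nat.iter l V (V (z i) ⊖ z (S i))) _ (K * e * INR i) (K * e)).
    + rewrite (Nat.iter_succ_r l), (Nat.iter_succ i), <- (proj1 (iter_linear _ V l HV)).
      f_equal; rewrite (is_linear_sub _ _ V) by exact HV; vec.
    + apply IH; [lia|]; intros a Ha; apply Hz; lia.
    + apply opnorm_bound; [exact HK|apply Hst; lia|apply Hz; lia].
    + rewrite S_INR; lra.
Qed.

Lemma last_step_before (h r : R) (k : nat) :
  0 <= r -> r < INR k * h ->
  exists k0, (k0 < k)%nat /\ INR k0 * h <= r < INR k0 * h + h.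
Proof.
  intro Hr; induction k as [|k IH]; intro Hk; [simpl in Hk; lra|].
  destruct (Rlt_le_dec r (INR k * h)) as [H|H].
  - destruct (IH H) as [k0 [H0 H1]]; exists k0; split; [lia|exact H1].
  - exists k; split; [lia|]; rewrite S_INR in Hk; lra.
Qed.

Lemma eventually_step (t : R) (Q : R -> nat -> Prop) :
  0 < t -> eventually Q ->
  exists N, forall n m, (N <= n)%nat -> (N <= m)%nat ->
    (1 <= n)%nat /\ 0 < t / INR n /\ Q (t / INR n) m.
Proof.
  intros Ht [d [N [Hd HQ]]]; destruct (INR_unbounded (t / d)) as [N' HN'].
  exists (S (max N N')); intros n m Hn Hm.
  assert (Hn' : INR N' <= INR n) by (apply le_INR; lia).
  assert (Hn0 : 0 < INR n) by (apply lt_0_INR; lia).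
  assert (0 < t / INR n) by (apply Rdiv_lt_0_compat; lra).
  split; [lia|]; split; [assumption|]; apply HQ; [split; [assumption|]|lia].
  assert (t / d * d = t) by (field; lra); assert (t / INR n * INR n = t) by (field; lra).
  nra.
Qed.

(** [D0] is a core: it is dense in [D] for the graph norm. *)
Lemma closure_approx (X : Banach) (D0 : X -> Prop) (A0 : X -> X) (D : X -> Prop) (A : X -> X)
  (x : X) (e : R) :
  is_closure D0 A0 D A -> D x -> 0 < e ->
  exists y, D0 y /\ bnorm (y ⊖ x) <= e /\ bnorm (A0 y ⊖ A x) <= e.
Proof.
  intros Hcl Dx He; destruct (proj1 (Hcl x (A x)) (conj Dx eq_refl)) as [u [Hu [H1 H2]]].
  destruct (H1 e He) as [N1 HN1], (H2 e He) as [N2 HN2].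
  exists (u (max N1 N2)); split; [apply Hu|]; split; left; [apply HN1|apply HN2]; lia.
Qed.

Section Convergence.

(** [V] is any linear one-step scheme consistent on the core; stability is asked only for at most
    [n] steps of size [t / INR n], that is up to time [t]. *)
Context {X : Banach} {Xm : nat -> Banach} (P : forall m, X -> Xm m) (c : R)
  (Hc : 0 <= c) (HPl : forall m, is_linear (P m)) (HPn : forall m, opnorm_le (P m) c)
  (V : forall m, R -> Xm m -> Xm m) (HVl : forall m h, 0 <= h -> is_linear (V m h))
  (D0 : X -> Prop) (G0 : X -> X) (D : X -> Prop) (G : X -> X) (U : R -> X -> X)
  (Hcl : is_closure D0 G0 D G) (HU : generates D G U)
  (Hcons : forall y e, D0 y -> 0 < e ->
     eventually (fun h m => bnorm (V m h (P m y) ⊖ P m y ⊖ h ⊙ P m (G0 y)) <= e * h))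
  (t K : R) (Ht : 0 < t) (HK : 0 <= K)
  (Hst : forall n m k, (1 <= n)%nat -> (k <= n)%nat ->
     opnorm_le (Nat.iter k (V m (t / INR n))) K).

(* The error is measured after any further [l] steps of the scheme, so that
   bounds over consecutive time intervals add up without a factor [K] per interval. *)
Definition error_bound (x : X) (E s : R) : Prop :=
  exists N, forall n m, (N <= n)%nat -> (N <= m)%nat ->
    forall k l, (l + k <= n)%nat -> INR k * (t / INR n) <= s ->
    bnorm (Nat.iter l (V m (t / INR n))
      (Nat.iter k (V m (t / INR n)) (P m x) ⊖ P m (U (INR k * (t / INR n)) x))) <= E.

(* [U] is compared with the affine path joining points [y0], [y1] of the core [D0]
   that are close, in graph norm, to [U r x] and [U s x]. *)
Lemma error_bound_cell (x : X) (E e r s : R) :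
  D x -> 0 < e -> 0 <= r < s ->
  (forall q, r <= q <= s -> bnorm (U q (G x) ⊖ U r (G x)) <= e) ->
  error_bound x E r -> error_bound x (E + K * (2 + 21 * c) * e * (s - r)) s.
Proof.
  intros Dx He Hrs Hosc [N0 HN0].
  pose proof HU as [HC0 _]; pose proof (C0_cont X U x HC0) as Hcont.
  destruct HC0 as [_ [_ [HUadd _]]].
  destruct (generator_orbit _ _ _ _ x r HU Dx ltac:(lra)) as [Dr Gr].
  destruct (generator_orbit _ _ _ _ x s HU Dx ltac:(lra)) as [Ds Gs].
  set (g := U r (G x)) in *; set (tau := s - r).
  assert (Htau : 0 < tau) by (unfold tau; lra).
  assert (Het : 0 < e * tau) by (apply Rmult_lt_0_compat; assumption).
  assert (Hinc : forall q, r <= q <= s ->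
    bnorm (U q x ⊖ U r x ⊖ (q - r) ⊙ g) <= e * (q - r)).
  { intros q Hq; replace (U q x) with (U (q - r) (U r x))
      by (rewrite <- HUadd by lra; f_equal; ring).
    apply (generator_increment _ _ _ _ _ _ _ _ HU Dr); [lra|]; intros p Hp.
    rewrite Gr; unfold g at 1; rewrite <- HUadd by lra; apply Hosc; lra. }
  (* Two requirements: [delta <= e] for the values of [G0], and [delta <= e * tau] because the
     endpoint errors are divided by [tau] in the slope [d]. *)
  set (delta := Rmin e (e * tau)).
  assert (Hde : delta <= e) by apply Rmin_l.
  assert (Hdt : delta <= e * tau) by apply Rmin_r.
  assert (Hd0 : 0 < delta) by (apply Rmin_pos; assumption).
  destruct (closure_approx _ _ _ _ _ _ delta Hcl Dr Hd0) as [y0 [Dy0 [Hy0 HG0]]].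
  destruct (closure_approx _ _ _ _ _ _ delta Hcl Ds Hd0) as [y1 [Dy1 [Hy1 HG1]]].
  rewrite Gr in HG0; rewrite Gs in HG1; fold g in HG0.
  assert (HG1' : bnorm (G0 y1 ⊖ g) <= 2 * e).
  { apply (bnorm_add2 _ (G0 y1 ⊖ U s (G x)) (U s (G x) ⊖ g) _ e e);
      [vec|lra|apply Hosc; lra|lra]. }
  (* Slope of the path; the orbit increment and the two endpoint errors contribute [e] each to
     [3 * e]. *)
  set (d := / tau ⊙ (y1 ⊖ y0)).
  assert (Hd : bnorm (d ⊖ g) <= 3 * e).
  { replace (d ⊖ g) with (/ tau ⊙ ((U s x ⊖ U r x ⊖ (s - r) ⊙ g) ⊕ (y1 ⊖ U s x) ⊕
      bopp (y0 ⊖ U r x))) by (unfold d; fold tau; vec).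
    replace (3 * e) with (/ tau * (3 * (e * tau))) by (field; lra).
    apply bnorm_scal_le; [left; apply Rinv_0_lt_compat; lra|].
    eapply bnorm_add3; [reflexivity|apply Hinc; lra|exact Hy1|rewrite bnorm_opp; exact Hy0|].
    fold tau; lra. }
  (* [h < d1] makes [h] times the norm of [g] at most [e * tau]; [h < d2] keeps the orbit within
     [e * tau] of [U r x] at the last grid time not after [r]. *)
  destruct (eps_scale (bnorm g) (e * tau) (bnorm_ge0 _ g) Het) as [d1 [Hd1 Hgd]].
  destruct (Hcont r ltac:(lra) (e * tau) Het) as [d2 [Hd2 Hcr]].
  destruct (eventually_step t _ Ht (eventually_and _ _ (eventually_small tau Htau)
    (eventually_and _ _ (eventually_small d1 Hd1)
    (eventually_and _ _ (eventually_small d2 Hd2)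
    (eventually_and _ _ (Hcons y0 e Dy0 He) (Hcons y1 e Dy1 He)))))) as [N1 HN1].
  exists (max N0 N1); intros n m Hn Hm k l Hkl Hks.
  specialize (HN0 n m ltac:(lia) ltac:(lia)).
  destruct (HN1 n m ltac:(lia) ltac:(lia)) as [Hn1 [Hh [Hht [Hh1 [Hh2 [Hc0 Hc1]]]]]].
  specialize (Hst n m).
  set (h := t / INR n) in *.
  assert (Hpos : 0 <= K * (2 + 21 * c) * e * tau).
  { repeat apply Rmult_le_pos; lra. }
  destruct (Rle_dec (INR k * h) r) as [Hkr|Hkr].
  { apply Rle_trans with E; [apply HN0; assumption|lra]. }
  (* The path starts from [y0] at the grid time [INR k0 * h], which precedes [r] by less than one
     step. *)
  destruct (last_step_before h r k ltac:(lra) ltac:(lra)) as [k0 [Hk0 Hk0r]].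
  set (i := (k - k0)%nat); assert (Hki : k = (i + k0)%nat) by (unfold i; lia); clearbody i.
  assert (Hkih : INR k * h = INR i * h + INR k0 * h) by (rewrite Hki, plus_INR; ring).
  pose proof (HVl m h ltac:(lra)) as HV.
  pose proof (HPl m) as HPm.
  set (z := fun a : nat => P m (y0 ⊕ (INR a * h) ⊙ d)).
  assert (HPg : forall y, bnorm (G0 y ⊖ g) <= 2 * e ->
    bnorm (V m h (P m y) ⊖ P m y ⊖ h ⊙ P m (G0 y)) <= e * h ->
    bnorm (V m h (P m y) ⊖ P m y ⊖ h ⊙ P m g) <= (1 + 2 * c) * e * h).
  { intros y Hy1' Hy2.
    apply (bnorm_add2 _ (V m h (P m y) ⊖ P m y ⊖ h ⊙ P m (G0 y)) (h ⊙ P m (G0 y ⊖ g)) _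
      (e * h) (h * (c * (2 * e)))).
    - rewrite (is_linear_sub _ _ (P m)) by exact HPm; vec.
    - exact Hy2.
    - apply bnorm_scal_le; [lra|apply opnorm_bound; [exact Hc|apply HPn|exact Hy1']].
    - lra. }
  assert (Hstep : forall a, (a < i)%nat ->
    bnorm (V m h (z a) ⊖ z (S a)) <= (1 + 5 * c) * e * h).
  { intros a Ha.
    assert (Hai : INR a + 1 <= INR i) by (rewrite <- S_INR; apply le_INR; lia).
    assert (Hah : (INR a + 1) * h <= INR i * h) by (apply Rmult_le_compat_r; lra).
    assert (Ha0 : 0 <= INR a * h) by (apply Rmult_le_pos; [apply pos_INR|lra]).
    (* Position on the segment from [y0] to [y1]: as [INR k0 * h + h > r], the first [i - 1] steps
       last less than [tau], so [lam <= 1]. By linearity, consistency at [y0] and [y1] is then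
       enough. *)
    set (lam := INR a * h / tau).
    assert (Hlam : lam * tau = INR a * h) by (unfold lam; field; lra).
    assert (Hlam0 : 0 <= lam) by (apply Rle_mult_inv_pos; assumption).
    assert (Hlam1 : lam <= 1).
    { apply Rmult_le_reg_r with tau; [lra|]; rewrite Hlam; unfold tau; lra. }
    apply (bnorm_add3 _ ((1 - lam) ⊙ (V m h (P m y0) ⊖ P m y0 ⊖ h ⊙ P m g))
      (lam ⊙ (V m h (P m y1) ⊖ P m y1 ⊖ h ⊙ P m g)) (bopp (h ⊙ P m (d ⊖ g))) _
      ((1 - lam) * ((1 + 2 * c) * e * h)) (lam * ((1 + 2 * c) * e * h)) (h * (c * (3 * e)))).
    - unfold z; rewrite S_INR.
      replace (y0 ⊕ (INR a * h) ⊙ d) with ((1 - lam) ⊙ y0 ⊕ lam ⊙ y1)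
        by (rewrite <- Hlam; unfold d; vec).
      replace (y0 ⊕ ((INR a + 1) * h) ⊙ d) with ((1 - lam) ⊙ y0 ⊕ lam ⊙ y1 ⊕ h ⊙ d)
        by (rewrite Rmult_plus_distr_r, <- Hlam; unfold d; vec).
      rewrite (is_linear_sub _ _ _ _ _ HPm), !(proj1 HPm), !(proj2 HPm), (proj1 HV), !(proj2 HV).
      vec.
    - apply bnorm_scal_le; [lra|]; apply HPg; [lra|exact Hc0].
    - apply bnorm_scal_le; [lra|]; apply HPg; [lra|exact Hc1].
    - rewrite bnorm_opp; apply bnorm_scal_le; [lra|].
      apply opnorm_bound; [exact Hc|apply HPn|exact Hd].
    - lra. }
  (* The [i] steps may exceed [tau], but by less than [h < tau]. *)
  assert (Hih : 0 <= INR i * h <= 2 * tau).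
  { split; [apply Rmult_le_pos; [apply pos_INR|lra]|unfold tau in *; lra]. }
  assert (Hk0h : 0 <= INR k0 * h) by (apply Rmult_le_pos; [apply pos_INR|lra]).
  assert (Hstart : bnorm (U (INR k0 * h) x ⊖ y0) <= 2 * e * tau).
  { apply (bnorm_add2 _ (U (INR k0 * h) x ⊖ U r x) (bopp (y0 ⊖ U r x)) _ (e * tau) (e * tau)).
    - vec.
    - left; apply Hcr; [exact Hk0h|apply Rabs_def1; lra].
    - rewrite bnorm_opp; lra.
    - lra. }
  (* Of the nine parts, one comes from the orbit increment, seven from [y0] and the slope error over
     a time of at most [2 * tau], one from the shift of the start to the grid. *)
  assert (Hend : bnorm (y0 ⊕ (INR i * h) ⊙ d ⊖ U (INR k * h) x) <= 9 * e * tau).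
  { apply (bnorm_add3 _ (bopp (U (INR k * h) x ⊖ U r x ⊖ (INR k * h - r) ⊙ g))
      ((y0 ⊖ U r x) ⊕ (INR i * h) ⊙ (d ⊖ g)) ((r - INR k0 * h) ⊙ g) _
      (e * tau) (7 * e * tau) (e * tau)).
    - rewrite Hkih; vec.
    - rewrite bnorm_opp; apply Rle_trans with (1 := Hinc (INR k * h) ltac:(lra)).
      apply Rmult_le_compat_l; unfold tau; lra.
    - apply (bnorm_add2 _ (y0 ⊖ U r x) ((INR i * h) ⊙ (d ⊖ g)) _
        (e * tau) (2 * tau * (3 * e))); [reflexivity|lra| |lra].
      rewrite bnorm_scal, Rabs_right by lra.
      apply Rmult_le_compat; [lra|apply bnorm_ge0|lra|exact Hd].
    - rewrite bnorm_scal, Rabs_right by lra.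
      pose proof (bnorm_ge0 _ g); nra.
    - lra. }
  assert (Htel : bnorm (Nat.iter l (V m h) (Nat.iter i (V m h) (z 0%nat) ⊖ z i))
    <= K * (2 * (1 + 5 * c)) * e * tau).
  { eapply Rle_trans.
    { apply (iter_telescope _ _ K ((1 + 5 * c) * e * h) n); [exact HV|exact HK| |lia|exact Hstep].
      intros; apply Hst; assumption. }
    assert (0 <= K * (1 + 5 * c) * e) by (repeat apply Rmult_le_pos; lra).
    nra. }
  (* In units of [K * e * tau], [2 * c] from the start, [2 * (1 + 5 * c)] from the steps and [9 * c]
     from the end add up to [2 + 21 * c]. *)
  apply (bnorm_add3 _
    (Nat.iter (l + i) (V m h) (Nat.iter k0 (V m h) (P m x) ⊖ P m (U (INR k0 * h) x)))
    (Nat.iter (l + i) (V m h) (P m (U (INR k0 * h) x ⊖ y0)))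
    (Nat.iter l (V m h) (Nat.iter i (V m h) (z 0%nat) ⊖ z i) ⊕
     Nat.iter l (V m h) (P m (y0 ⊕ (INR i * h) ⊙ d ⊖ U (INR k * h) x))) _
    E (K * (c * (2 * e * tau))) (K * (2 * (1 + 5 * c)) * e * tau + K * (c * (9 * e * tau)))).
  - assert (Hz0 : z 0%nat = P m y0) by (unfold z; f_equal; simpl INR; vec).
    rewrite Hz0; unfold z.
    pose proof (iter_linear _ _ l HV) as HL; pose proof (iter_linear _ _ i HV) as HI.
    replace (Nat.iter k (V m h) (P m x)) with (Nat.iter i (V m h) (Nat.iter k0 (V m h) (P m x)))
      by (rewrite <- Nat.iter_add, <- Hki; reflexivity).
    rewrite !Nat.iter_add.
    rewrite !(is_linear_sub _ _ _ _ _ HPm), !(is_linear_sub _ _ _ _ _ HI),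
      !(is_linear_sub _ _ _ _ _ HL); vec.
  - apply HN0; [lia|lra].
  - apply opnorm_bound; [exact HK|apply Hst; lia|].
    apply opnorm_bound; [exact Hc|apply HPn|exact Hstart].
  - eapply bnorm_add2; [reflexivity|exact Htel| |apply Rle_refl].
    apply opnorm_bound; [exact HK|apply Hst; lia|].
    apply opnorm_bound; [exact Hc|apply HPn|exact Hend].
  - fold tau; lra.
Qed.

(** [error_bound] is propagated along cells on which the orbit of [G x] oscillates little, growing
    at rate [C * e']; the claim is the case [k = n], [l = 0] at time [t]. *)
Lemma iterates_converge (x : X) (e : R) :
  D x -> 0 < e ->
  exists N, forall n m, (N <= n)%nat -> (N <= m)%nat ->
    bnorm (Nat.iter n (V m (t / INR n)) (P m x) ⊖ P m (U t x)) <= e.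
Proof.
  intros Dx He; set (C := K * (2 + 21 * c)).
  assert (HC : 0 <= C) by (apply Rmult_le_pos; lra).
  destruct (eps_scale (C * t) e ltac:(apply Rmult_le_pos; lra) He) as [e' [He' Hee]].
  pose proof HU as [HC0 _].
  assert (Herr : error_bound x (C * e' * t) t).
  { apply (cell_induction X (fun s => U s (G x)) t e' (fun s => error_bound x (C * e' * s) s));
      [apply C0_cont, HC0|lra|exact He'| |].
    - exists 1%nat; intros n m Hn _ k l _ Hk.
      assert (Hh : 0 < t / INR n) by (apply Rdiv_lt_0_compat; [lra|apply lt_0_INR; lia]).
      destruct k as [|k].
      + simpl Nat.iter; simpl INR; rewrite Rmult_0_l, (generates_0 _ _ _ _ x HU).
        replace (P m x ⊖ P m x) with (bzero : Xm m) by vec.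
        rewrite is_linear_0, bnorm_0 by (apply iter_linear, HVl; lra); lra.
      + exfalso; rewrite S_INR in Hk; pose proof (pos_INR k); nra.
    - intros r s Hr _ Hosc Hb.
      replace (C * e' * s) with (C * e' * r + K * (2 + 21 * c) * e' * (s - r))
        by (unfold C; ring).
      apply error_bound_cell; assumption. }
  (* [S N] excludes [n = 0], for which [INR n * (t / INR n)] is not [t]. *)
  destruct Herr as [N HN]; exists (S N); intros n m Hn Hm.
  assert (Hnt : INR n * (t / INR n) = t) by (field; apply not_0_INR; lia).
  specialize (HN n m ltac:(lia) ltac:(lia) n 0%nat ltac:(lia)).
  rewrite Hnt in HN.
  apply Rle_trans with (1 := HN (Rle_refl t)); lra.
Qed.

End Convergence.

(** * The weighted splitting *)

Lemma mult_exp_le (M a b : R) : 0 <= M -> a <= b -> M * exp a <= M * exp b.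
Proof.
  intros HM [Hab | ->]; [|apply Rle_refl].
  apply Rmult_le_compat_l; [exact HM|left; apply exp_increasing, Hab].
Qed.

Lemma one_le_mult_exp (M a : R) : 1 <= M -> 1 <= M * exp (Rabs a).
Proof.
  intro HM; apply Rle_trans with (M * exp 0); [rewrite exp_0; lra|].
  apply mult_exp_le; [lra|apply Rabs_pos].
Qed.

Lemma Rabs_mult_le (a h : R) : 0 <= h <= 1 -> a * h <= Rabs a.
Proof. intro Hh; pose proof (Rle_abs a); pose proof (Rabs_pos a); nra. Qed.

Theorem mainTheorem7
  (* standing setting *)
  (X : Banach)
  (DA : X -> Prop) (A : X -> X) (DB : X -> Prop) (B : X -> X)
  (T S U : R -> X -> X) (DAB : X -> Prop) (AB : X -> X)
  (hA_cl : closed_op DA A) (hA_dense : densely_defined DA)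
  (hB_cl : closed_op DB B) (hB_dense : densely_defined DB)
  (hA_gen : generates DA A T) (hB_gen : generates DB B S)
  (hAB_closure : is_closure (fun x => DA x /\ DB x) (fun x => badd (A x) (B x)) DAB AB)
  (hAB_dom : forall x, DA x -> DB x -> DAB x)
  (hAB_gen : generates DAB AB U)
  (* approximation setting *)
  (Xm : nat -> Banach)
  (P : forall m, X -> Xm m) (J : forall m, Xm m -> X)
  (MJ MP : R)
  (hP_lin : forall m, bounded_linear (P m)) (hJ_lin : forall m, bounded_linear (J m))
  (hPJ : forall m (y : Xm m), P m (J m y) = y)
  (hJP : forall x, seq_lim (fun m => J m (P m x)) x)
  (hJ_bd : forall m, opnorm_le (J m) MJ) (hP_bd : forall m, opnorm_le (P m) MP)
  (DAm : forall m, Xm m -> Prop) (Am : forall m, Xm m -> Xm m)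
  (DBm : forall m, Xm m -> Prop) (Bm : forall m, Xm m -> Xm m)
  (Tm Sm : forall m, R -> Xm m -> Xm m)
  (hAm_gen : forall m, generates (DAm m) (Am m) (Tm m))
  (hBm_gen : forall m, generates (DBm m) (Bm m) (Sm m))
  (Theta : R) (hTheta : 0 < Theta < 1)
  (* stability *)
  (MT wT : R) (hMT : 1 <= MT)
  (hS1 : forall h, 0 < h -> opnorm_le (T h) (MT * exp (wT * h)) /\
           forall m, opnorm_le (Tm m h) (MT * exp (wT * h)))
  (MS wS : R) (hMS : 1 <= MS)
  (hS2 : forall h, 0 < h -> opnorm_le (S h) (MS * exp (wS * h)) /\
           forall m, opnorm_le (Sm m h) (MS * exp (wS * h)))
  (M w : R) (hM : 1 <= M)
  (hSw : forall t (k n m : nat), 0 <= t -> (1 <= k)%nat -> (1 <= n)%nat ->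
           opnorm_le (Nat.iter k (weighted_op Theta (Sm m) (Tm m) (t / INR n)))
                     (M * exp (INR k * w * t / INR n)))
  (* consistency *)
  (hC1 : forall x, DA x -> (forall m, DAm m (P m x)) /\
           seq_lim (fun m => J m (Am m (P m x))) (A x))
  (hC2 : forall x, DB x -> (forall m, DBm m (P m x)) /\
           seq_lim (fun m => J m (Bm m (P m x))) (B x)) :
  forall t, 0 < t -> forall x : X,
    double_lim
      (fun n m => J m (Nat.iter n (weighted_op Theta (Sm m) (Tm m) (t / INR n)) (P m x)))
      (U t x).
Proof.
  assert (HP : approx_scheme P J (Rabs MP)).
  { split; [apply Rabs_pos|]; split; [intro m; apply hP_lin|]; split; [|exact hPJ].
    intro m; apply opnorm_le_weaken with (2 := hP_bd m), Rle_abs. }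
  assert (HfA : consistent_family P J DA A DAm Am Tm (MT * exp (Rabs wT))).
  { split; [exact hA_dense|]; split; [exact hAm_gen|].
    split; [apply one_le_mult_exp, hMT|]; split; [|exact hC1].
    intros h m Hh; apply opnorm_le_weaken with (MT * exp (wT * h)).
    - apply mult_exp_le; [lra|]; apply Rabs_mult_le; lra.
    - apply (hS1 h); lra. }
  assert (HfB : consistent_family P J DB B DBm Bm Sm (MS * exp (Rabs wS))).
  { split; [exact hB_dense|]; split; [exact hBm_gen|].
    split; [apply one_le_mult_exp, hMS|]; split; [|exact hC2].
    intros h m Hh; apply opnorm_le_weaken with (MS * exp (wS * h)).
    - apply mult_exp_le; [lra|]; apply Rabs_mult_le; lra.
    - apply (hS2 h); lra. }
  pose proof HP as [Hc [HPl [HPn _]]].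
  intros t Ht x e He.
  (* Dominates the stability bound for all [1 <= k <= n], whatever the sign of [w]; since [1 <= K],
     it also covers [k = 0]. *)
  set (K := M * exp (Rabs (w * t))).
  assert (HK : 1 <= K) by apply one_le_mult_exp, hM.
  assert (Hst : forall n m k, (1 <= n)%nat -> (k <= n)%nat ->
    opnorm_le (Nat.iter k (weighted_op Theta (Sm m) (Tm m) (t / INR n))) K).
  { intros n m k Hn Hk; destruct k as [|k].
    - intro y; simpl Nat.iter; pose proof (bnorm_ge0 _ y); nra.
    - apply opnorm_le_weaken with (2 := hSw t (Datatypes.S k) n m ltac:(lra) ltac:(lia) Hn).
      apply mult_exp_le; [lra|].
      assert (0 < INR n) by (apply lt_0_INR; lia).
      assert (INR (Datatypes.S k) <= INR n) by (apply le_INR; lia).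
      replace (INR (Datatypes.S k) * w * t / INR n) with (w * t * (INR (Datatypes.S k) / INR n)) by (field; lra).
      apply Rabs_mult_le; split.
      + apply Rle_mult_inv_pos; [apply pos_INR|assumption].
      + apply Rmult_le_reg_r with (INR n); [assumption|].
        replace (INR (Datatypes.S k) / INR n * INR n) with (INR (Datatypes.S k)) by (field; lra); lra. }
  clearbody K.
  assert (HVl : forall m h, 0 <= h -> is_linear (weighted_op Theta (Sm m) (Tm m) h)).
  { intros m h Hh; apply weighted_op_linear; eapply generates_linear; eauto. }
  assert (Hcons : forall y e, DA y /\ DB y -> 0 < e -> eventually (fun h m =>
    bnorm (weighted_op Theta (Sm m) (Tm m) h (P m y) ⊖ P m y ⊖ h ⊙ P m (A y ⊕ B y)) <= e * h)).
  { intros y e' [Ay By] He'.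
    apply (weighted_derivative HP _ _ _ _ _ _ _ _ _ _ _ _ _ _ _ HfA HfB); (assumption || lra). }
  pose proof hAB_gen as [[HUbl _] _].
  pose proof (proj1 (HUbl t ltac:(lra))) as HUl.
  destruct (bounded_linear_bound _ _ _ (HUbl t ltac:(lra))) as [CU [HCU HUn]].
  set (j := Rabs MJ).
  assert (Hj : 0 <= j) by apply Rabs_pos.
  assert (HJn : forall m, opnorm_le (J m) j).
  { intro m; apply opnorm_le_weaken with (2 := hJ_bd m), Rle_abs. }
  (* One term each for replacing [x] by [y] in the scheme, the error of the scheme at [y], the
     distance of [J m (P m (U t y))] from [U t y], and replacing [y] by [x] under [U t]. *)
  assert (HjK : 0 <= j * (K * Rabs MP) + j + 1 + CU).
  { assert (0 <= j * (K * Rabs MP)) by (repeat apply Rmult_le_pos; lra); lra. }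
  destruct (eps_scale _ e HjK He) as [e' [He' Hee]].
  destruct (generator_dense _ _ _ _ hAB_gen x e' He') as [y [Dy Hxy]].
  destruct (iterates_converge P _ Hc HPl HPn (fun m => weighted_op Theta (Sm m) (Tm m)) HVl
    _ _ _ _ _ hAB_closure hAB_gen Hcons t K Ht ltac:(lra) Hst y e' Dy He') as [N1 HN1].
  destruct (hJP (U t y) e' He') as [N2 HN2].
  exists (Datatypes.S (max N1 N2)); intros n m Hn Hm.
  specialize (HN1 n m ltac:(lia) ltac:(lia)); specialize (HN2 m ltac:(lia)); cbv beta in HN1.
  specialize (Hst n m n ltac:(lia) ltac:(lia)).
  set (W := Nat.iter n (weighted_op Theta (Sm m) (Tm m) (t / INR n))) in *.
  assert (HW : is_linear W).
  { apply iter_linear, HVl; left; apply Rdiv_lt_0_compat; [lra|apply lt_0_INR; lia]. }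
  pose proof (proj1 (hJ_lin m)) as HJl.
  apply (bnorm_add3 _ (J m (W (P m (x ⊖ y)))) (J m (W (P m y) ⊖ P m (U t y)))
    ((J m (P m (U t y)) ⊖ U t y) ⊕ bopp (U t (x ⊖ y))) _
    (j * (K * (Rabs MP * e'))) (j * e') (e' + CU * e')).
  - rewrite (is_linear_sub _ _ _ _ _ (HPl m)), (is_linear_sub _ _ _ _ _ HW),
      !(is_linear_sub _ _ _ _ _ HJl), (is_linear_sub _ _ _ _ _ HUl); vec.
  - apply opnorm_bound; [exact Hj|apply HJn|].
    apply opnorm_bound; [lra|exact Hst|].
    apply opnorm_bound; [exact Hc|apply HPn|lra].
  - apply opnorm_bound; [exact Hj|apply HJn|exact HN1].
  - eapply bnorm_add2; [reflexivity|left; exact HN2| |apply Rle_refl].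
    rewrite bnorm_opp; apply opnorm_bound; [exact HCU|exact HUn|lra].
  - lra.
Qed.
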